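(* Let $p$ be an odd prime which is a rogue prime and let $i\in\{1,2\}$. Then the rogue sequence $\langle(-1)^{i+1}\rangle_i^p$ has exactly $O_p(2)-1$ terms, and $O_p(2)-1\le\frac{p-3}{2}$. If $\langle g\rangle_i^p$ is a rogue loop in $A_i^p$, then the set of its terms has exactly $O_p(2)$ elements; in particular every rogue loop has length at most $\frac{p-1}{2}$. Finally, the number of distinct (pairwise disjoint) rogue loops in $A_i^p$, i.e. the number of distinct sets that arise as the set of terms of a rogue loop $\langle g\rangle_i^p$, $g\in A_i^p$, is $\frac{p-1}{O_p(2)}-1$.
   Context: $O_p(2)$ denotes the multiplicative order of $2$ in $(\mathbb{Z}/p\mathbb{Z})^\times$. For an odd prime $p$ and $i\in\{1,2\}$, let $A_i^p=(\mathbb{Z}/p\mathbb{Z})^\times\setminus\{(-1)^i \bmod p\}$. For $g\in A_i^p$ define $u_1=g$ and $u_n=2u_{n-1}+(-1)^{i+1}$ in $\mathbb{Z}/p\mathbb{Z}$ for $n>1$; let $g_k^i=\min(\{n\in\mathbb{N}: u_n=0\}\cup\{\infty\})$, and call $\langle g\rangle_i^p=(u_n)_{1\le n<g_k^i}$ the rogue sequence of $g$. A rogue loop is a periodic rogue sequence (one never reaching $0$); its length is the size of its set of terms. $p$ is a rogue prime if for some $j\in\{1,2\}$ some $\langle g\rangle_j^p$ is a rogue loop; equivalently, $2$ is not a primitive root modulo $p$. *)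

(* Defs.v *)
From HB Require Import structures.
From mathcomp Require Import all_boot all_order all_algebra all_fingroup.
From mathcomp Require Import boolp.

Set Implicit Arguments.
Unset Strict Implicit.
Unset Printing Implicit Defensive.

Import GRing.Theory.
Local Open Scope ring_scope.

(* For p prime, 'F_p is Z/pZ. The default value 1 of insubd is only used when
   2 is not invertible, see val_unit2. *)
Definition unit2 (p : nat) : {unit 'F_p} := insubd (1%g : {unit 'F_p}) (2%:R : 'F_p).

Lemma val_unit2 (p : nat) : prime p -> odd p -> val (unit2 p) = 2%:R :> 'F_p.
Proof.
move=> p_pr p_odd; rewrite /unit2 insubdK //= -topredE /= unitfE.
by rewrite -(dvdn_pcharf (pchar_Fp p_pr)) dvdn_prime2 //; case: eqP p_odd => // ->.
Qed.

Definition ord2 (p : nat) : nat := #[unit2 p]%g.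

Definition rogueA (p i : nat) : {set 'F_p} :=
  [set g | (g \is a GRing.unit) && (g != (-1) ^+ i)].

(* The sequence is indexed from 1; the value at n = 0 is meaningless and every
   use below requires 0 < n. *)
Definition rogue_u (p i : nat) (g : 'F_p) (n : nat) : 'F_p :=
  iter n.-1 (fun x => 2%:R * x + (-1) ^+ i.+1) g.

(* min ({n >= 1 | u_n = 0} U {oo}), where None stands for oo. *)
Definition rogue_end (p i : nat) (g : 'F_p) : option nat :=
  match pselect (exists n, (0 < n)%N && (rogue_u i g n == 0)) with
  | left ex_zero => Some (ex_minn ex_zero)
  | right _ => None
  end.

Definition rogue_index (p i : nat) (g : 'F_p) (n : nat) : bool :=
  (0 < n)%N && (if rogue_end i g is Some k then (n < k)%N else true).

(* The number of indices n with 1 <= n < rogue_end i g, where None stands for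
   oo. *)
Definition rogue_size (p i : nat) (g : 'F_p) : option nat :=
  omap predn (rogue_end i g).

Definition rogue_terms (p i : nat) (g : 'F_p) : {set 'F_p} :=
  [set x | `[< exists2 n, rogue_index i g n & rogue_u i g n = x >]].

Definition rogue_loop (p i : nat) (g : 'F_p) : Prop :=
  [/\ g \in rogueA p i,
      rogue_end i g = None
    & exists2 t, (0 < t)%N &
        forall n, (0 < n)%N -> rogue_u i g (n + t) = rogue_u i g n].

Definition rogue_prime (p : nat) : Prop :=
  [/\ prime p, odd p
    & exists j, (j = 1%N \/ j = 2%N) /\ exists g : 'F_p, rogue_loop j g].

Definition rogue_loops (p i : nat) : {set {set 'F_p}} :=
  [set rogue_terms i g | g : 'F_p & `[< rogue_loop i g >]].

(* Main.v *)
Require Import Defs.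
From HB Require Import structures.
From mathcomp Require Import all_boot all_order all_algebra all_fingroup.
From mathcomp Require Import cyclic.
From mathcomp Require Import boolp.
From mathcomp Require Import lra.

Set Implicit Arguments.
Unset Strict Implicit.
Unset Printing Implicit Defensive.

Import Order.TTheory GRing.Theory Num.Theory.
Local Open Scope ring_scope.

(** Put [c = (-1)^(i+1)].  The recursion [x |-> 2 x + c] has fixed point [-c],
    so [u_n + c = 2^(n-1) (g + c)]: after translation by [c], the sequence of
    [g] runs through the coset of the subgroup generated by 2 that contains
    [g + c].  It reaches 0 exactly when this is the coset of [c], and every
    other coset is the translate of the set of terms of a rogue loop.  Hence
    rogue loops have [O_p(2)] terms and partition a set of
    [p - 1 - O_p(2)] elements; as a rogue prime has at least one loop,
    [2 O_p(2) <= p - 1]. *)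

Lemma rogue_uE (p i : nat) (g : 'F_p) (n : nat) :
  rogue_u i g n.+1 = 2 ^+ n * (g + (-1) ^+ i.+1) - (-1) ^+ i.+1.
Proof.
rewrite /rogue_u /=; elim: n => [|n IHn] /=; first by rewrite mul1r addrK.
by rewrite IHn mulrBr mulrA -exprS mulr_natl mulr2n opprD addrA addrNK.
Qed.

Lemma ord2_gt0 (p : nat) : (0 < ord2 p)%N.
Proof. exact: order_gt0. Qed.

Section OddPrime.

Variable p : nat.
Hypotheses (p_pr : prime p) (p_odd : odd p).

(** The order lives in the unit group, so the equation is pulled back along the injection [val],
    where equality of powers is congruence of exponents. *)
Lemma expr2_eq (a b : nat) :
  ((2 : 'F_p) ^+ a == 2 ^+ b) = (a == b %[mod ord2 p]).
Proof.
rewrite -(val_unit2 p_pr p_odd) -!FinRing.val_unitX (inj_eq val_inj).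
exact: eq_expg_mod_order.
Qed.

Lemma expr2_mod (a : nat) : (2 : 'F_p) ^+ (a %% ord2 p) = 2 ^+ a.
Proof. by apply/eqP; rewrite expr2_eq modn_mod. Qed.

Lemma expr2_neq0 (a : nat) : (2 : 'F_p) ^+ a != 0.
Proof.
rewrite -(val_unit2 p_pr p_odd) -FinRing.val_unitX -unitfE; exact: valP.
Qed.

(** Finite order provides inverses with natural exponents. The recursion only runs forward, and this
    allows going back along a coset. *)
Lemma expr2_inv (a : nat) : exists b, (2 : 'F_p) ^+ b * 2 ^+ a = 1.
Proof.
(* Reducing [a] first keeps the natural subtraction from truncating. *)
exists (ord2 p - a %% ord2 p)%N; rewrite -(expr2_mod a) -exprD subnK.
  by apply/eqP; rewrite -(expr0 (2 : 'F_p)) expr2_eq modnn mod0n.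
by rewrite ltnW // ltn_mod ord2_gt0.
Qed.

Lemma card_coset2 (h c : 'F_p) :
  h != 0 -> #|[set 2 ^+ k * h - c | k : 'I_(ord2 p)]| = ord2 p.
Proof.
move=> h0; rewrite card_imset ?card_ord // => a b /addIr /(mulIf h0) /eqP.
rewrite expr2_eq !modn_small // => /eqP; exact: val_inj.
Qed.

(** Frees the exponent from its bound, so that exponents can later be added without reduction. *)
Lemma mem_coset2 (h c x : 'F_p) :
  reflect (exists k, x + c = 2 ^+ k * h)
          (x \in [set 2 ^+ k * h - c | k : 'I_(ord2 p)]).
Proof.
apply: (iffP imsetP) => [[k _ ->]|[k xk]]; first by exists k; rewrite subrK.
exists (Ordinal (ltn_pmod k (ord2_gt0 p))) => //=.
by rewrite expr2_mod -xk addrK.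
Qed.

Section Sign.

Variable i : nat.
Let c : 'F_p := (-1) ^+ i.+1.

Let c_neq0 : c != 0. Proof. by rewrite signr_eq0. Qed.

Lemma rogue_uS_eq0 (g : 'F_p) (n : nat) :
  (rogue_u i g n.+1 == 0) = (2 ^+ n * (g + c) == c).
Proof. by rewrite rogue_uE subr_eq0. Qed.

Lemma rogue_endN (g : 'F_p) :
  rogue_end i g = None <-> forall k, 2 ^+ k * (g + c) != c.
Proof.
rewrite /rogue_end; case: pselect => [ex0|nex0]; split=> //.
  case: ex0 => -[|n] //= un0 /(_ n); rewrite -rogue_uS_eq0.
  by rewrite un0.
move=> _ k; apply/negP => ck; apply: nex0; exists k.+1.
by rewrite rogue_uS_eq0.
Qed.

(** The excluded value [(-1) ^+ i] is the fixed point [- c], and periodicity with period [ord2 p] is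
    automatic. *)
Lemma rogue_loopP (g : 'F_p) :
  rogue_loop i g <-> g + c != 0 /\ forall k, 2 ^+ k * (g + c) != c.
Proof.
have gA : (g != (-1) ^+ i) = (g + c != 0).
  by rewrite /c exprS mulN1r subr_eq0.
split=> [[]|[g0 gk]].
  by rewrite inE gA => /andP[_ ->] /rogue_endN.
split; [|exact/rogue_endN|].
  (* If [g] were 0, then [g + c] would equal [c], against exponent 0. *)
  rewrite inE gA g0 andbT unitfE; apply: contraNneq (gk 0%N) => ->.
  by rewrite add0r mul1r.
exists (ord2 p) => [|[|n] // _]; first exact: ord2_gt0.
by rewrite addSn !rogue_uE -(expr2_mod (n + _)) modnDr expr2_mod.
Qed.

Lemma rogue_termsE (g : 'F_p) : rogue_loop i g ->
  rogue_terms i g = [set 2 ^+ k * (g + c) - c | k : 'I_(ord2 p)].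
Proof.
case=> _ endN _; apply/setP => x; rewrite inE.
apply/asboolP/mem_coset2 => [[[|n]]|[k xk]].
- by rewrite /rogue_index.
- by move=> _ <-; exists n; rewrite rogue_uE subrK.
by exists k.+1; rewrite ?/rogue_index ?endN // rogue_uE -xk addrK.
Qed.

Lemma card_rogue_terms (g : 'F_p) :
  rogue_loop i g -> #|rogue_terms i g| = ord2 p.
Proof.
move=> gl; rewrite rogue_termsE // card_coset2 //.
by case/rogue_loopP: gl.
Qed.

Lemma mem_rogue_terms_id (g : 'F_p) : rogue_loop i g -> g \in rogue_terms i g.
Proof.
by move=> gl; rewrite rogue_termsE //; apply/mem_coset2; exists 0%N; rewrite mul1r.
Qed.

(** Any element of a coset generates the whole coset; this yields the disjointness of distinct
    loops. *)
Lemma rogue_terms_eq (g x : 'F_p) : rogue_loop i g -> x \in rogue_terms i g ->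
  rogue_loop i x /\ rogue_terms i x = rogue_terms i g.
Proof.
move=> gl; rewrite rogue_termsE // => /mem_coset2[a xa].
have [g0 gk] := (rogue_loopP g).1 gl.
have xl : rogue_loop i x.
  apply/rogue_loopP; split=> [|k]; rewrite xa.
    by rewrite mulf_neq0 ?expr2_neq0.
  by rewrite mulrA -exprD.
split=> //; rewrite rogue_termsE //; apply/setP => y.
apply/mem_coset2/mem_coset2 => -[b yb].
  by exists (b + a)%N; rewrite yb xa mulrA exprD.
have [d da] := expr2_inv a; exists (b + d)%N.
by rewrite yb xa exprD -!mulrA [X in _ = _ * X]mulrA da mul1r.
Qed.

Lemma rogue_loops_partition :
  partition (rogue_loops p i) [set g : 'F_p | `[< rogue_loop i g >]].
Proof.
apply/and3P; split.
- apply/eqP/setP => x; rewrite inE; apply/bigcupP/asboolP.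
    case=> _ /imsetP[g + ->]; rewrite inE => /asboolP gl xg.
    by case: (rogue_terms_eq gl xg).
  move=> xl; exists (rogue_terms i x); last exact: mem_rogue_terms_id.
  by apply/imsetP; exists x => //; rewrite inE; apply/asboolP.
- apply/trivIsetP => _ _ /imsetP[g + ->] /imsetP[h + ->].
  rewrite !inE => /asboolP gl /asboolP hl; apply: contraNT => /pred0Pn[x].
  case/andP=> /= /(rogue_terms_eq gl)[_ <-].
  by case/(rogue_terms_eq hl)=> _ <-.
- apply/imsetP => -[g]; rewrite inE => /asboolP gl g0.
  by have := mem_rogue_terms_id gl; rewrite -g0 inE.
Qed.

(** The elements that start no loop are the fixed point [- c] and the [ord2 p] elements of the
    translated coset of [c]. *)
Lemma card_rogue_loop_starts :
  (#|[set g : 'F_p | `[< rogue_loop i g >]]| + (ord2 p).+1 = p)%N.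
Proof.
have <- : #|~: [set g : 'F_p | `[< rogue_loop i g >]]| = (ord2 p).+1.
  rewrite -[in RHS](card_coset2 c c_neq0).
  set B := [set _ | _ in _].
  have NcB : - c \notin B.
    apply/negP => /mem_coset2[k /esym/eqP].
    by rewrite addNr mulf_eq0 (negPf (expr2_neq0 k)) (negPf c_neq0).
  have <- : #|- c |: B| = #|B|.+1 by rewrite cardsU1 NcB.
  congr #|pred_of_set _|.
  apply/setP => x; rewrite !inE.
  apply/asboolPn/orP => [nl|].
    have [->|xc] := eqVneq x (- c); [by left|right].
    apply: contra_notT nl => nB; apply/rogue_loopP; split=> [|k].
      by rewrite addr_eq0.
    (* Inverting [2 ^+ k] in [kc] exhibits [x + c] as a power of 2 times [c]. *)
    apply: contraNneq nB => kc; have [b bk] := expr2_inv k.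
    by apply/mem_coset2; exists b; rewrite -[in RHS]kc mulrA bk mul1r.
  case=> [/eqP->|/mem_coset2[k xk]] /rogue_loopP[].
    by rewrite addNr eqxx.
  have [b bk] := expr2_inv k.
  by move=> _ /(_ b); rewrite xk mulrA bk mul1r eqxx.
by rewrite cardsC card_Fp.
Qed.

(** The inner successor counts the coset of [c] beside the loops, the outer one the fixed point. *)
Lemma card_rogue_loops : ((#|rogue_loops p i|.+1 * ord2 p).+1 = p)%N.
Proof.
have loops_card : {in rogue_loops p i, forall A : {set 'F_p}, #|A| = ord2 p}.
  by move=> _ /imsetP[g + ->]; rewrite inE => /asboolP/card_rogue_terms.
have starts_card := card_uniform_partition loops_card rogue_loops_partition.
rewrite mulSn addnC -addnS -starts_card; exact: card_rogue_loop_starts.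
Qed.

(** Starting at [c] gives [g + c = 2c], so the term of index [n.+1] vanishes exactly when
    [2 ^+ n.+1 = 1]; the first zero is at index [ord2 p]. *)
Lemma rogue_size_sign : rogue_size i c = Some (ord2 p - 1)%N.
Proof.
have u0 n : (rogue_u i c n.+1 == 0) = (ord2 p %| n.+1)%N.
  rewrite rogue_uS_eq0 -mulr2n -(mulr_natl c) mulrA -exprSr.
  rewrite -{2}[c]mul1r (inj_eq (mulIf c_neq0)) -(expr0 2) expr2_eq mod0n.
  by rewrite /dvdn.
rewrite /rogue_size /rogue_end; case: pselect => [ex0|[]] /=.
  congr Some; rewrite -subn1; congr (_ - _)%N.
  case: ex_minnP => -[|m] // /andP[_]; rewrite u0 => om min_m.
  apply/eqP; rewrite eqn_leq (dvdn_leq _ om) // min_m //.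
  (* [u0] speaks of successor indices only, so the order is put in that form. *)
  have := ord2_gt0 p; case oE: (ord2 p) => [|o'] // _.
  by rewrite u0 oE dvdnn.
exists (ord2 p); have := ord2_gt0 p; case oE: (ord2 p) => [|o'] // _.
by rewrite u0 oE dvdnn.
Qed.

End Sign.

End OddPrime.

(** The given loop may belong to either sign [j], but the resulting bound does not mention the sign
    and so serves both. *)
Lemma rogue_prime_ord2 (p : nat) : rogue_prime p -> ((2 * ord2 p).+1 <= p)%N.
Proof.
case=> p_pr p_odd [j [_ [g gl]]].
have loops_gt0 : (0 < #|rogue_loops p j|)%N.
  apply/card_gt0P; exists (rogue_terms j g).
  by apply/imsetP; exists g; rewrite // inE; apply/asboolP.
have p_eq := card_rogue_loops p_pr p_odd j.
by rewrite -[leqRHS]p_eq ltnS leq_mul.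
Qed.

Theorem mainTheorem8 (p i : nat) (p_rogue : rogue_prime p)
    (hi : i = 1%N \/ i = 2%N) :
  [/\ rogue_size i ((-1) ^+ i.+1 : 'F_p) = Some (ord2 p - 1)%N,
      (ord2 p)%:R - 1 <= (p%:R - 3%:R) / 2%:R :> rat,
      forall g : 'F_p, rogue_loop i g ->
        #|rogue_terms i g| = ord2 p /\
        #|rogue_terms i g|%:R <= (p%:R - 1) / 2%:R :> rat,
      trivIset (rogue_loops p i)
    & #|rogue_loops p i|%:R = (p%:R - 1) / (ord2 p)%:R - 1 :> rat].
Proof.
have [p_pr p_odd _] := p_rogue.
(* Both upper bounds of the theorem are linear consequences of this inequality. *)
have le_p : 2 * (ord2 p)%:R + 1 <= p%:R :> rat.
  by rewrite -natrM natr1 ler_nat rogue_prime_ord2.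
split.
- exact: rogue_size_sign.
- lra.
- by move=> g gl; rewrite card_rogue_terms //; split=> //; lra.
- by case/and3P: (rogue_loops_partition p_pr p_odd i).
- have o0 : (ord2 p)%:R != 0 :> rat by rewrite pnatr_eq0 -lt0n ord2_gt0.
  rewrite -[in p%:R](card_rogue_loops p_pr p_odd i).
  by rewrite -natr1 addrK natrM mulfK // -natr1 addrK.
Qed.
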